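(* For every $n\ge 0$, the solution of the P-BDF1 scheme (defined in the context) conserves the total mass: $$\int_\Omega\phi_h^{n+1}\,d\mathbf x=\int_\Omega\phi_h^0\,d\mathbf x .$$
   Context: $\Omega\subset\mathbb R^d$ ($d=2,3$) is a bounded domain; $\gamma,\lambda,\mu>0$ are constants; $\tau>0$ is the time step; $(\cdot,\cdot)$ and $\|\cdot\|$ are the $L^2(\Omega)$ inner product and norm. $F:\mathbb R\to\mathbb R$ is a $C^1$ potential bounded from below (for example $F(\phi)=\frac{1}{4\epsilon^2}(\phi^2-1)^2$, $\epsilon>0$), $B$ is a constant with $F+B>0$, and $H(\nu)=F'(\nu)/\sqrt{F(\nu)+B}$. $C^0(\Omega)$ denotes functions continuous on $\bar\Omega$. $\mathcal T_h$ is a shape-regular, quasi-uniform partition of $\Omega$ into elements $K$, and $P_k(K)$ denotes polynomials of degree at most $k$ on $K$. The finite element spaces are $\mathbf X_h=\mathbf V_h=\{\mathbf v_h\in (C^0(\bar\Omega))^d\cap(H^1_0(\Omega))^d:\ \mathbf v_h|_K\in(P_2(K))^d\ \forall K\}$, $M_h=\{q_h\in C^0(\bar\Omega)\cap L^2_0(\Omega):\ q_h|_K\in P_1(K)\ \forall K\}$ ($L^2_0$ = zero-average $L^2$ functions), $Y_h=\{\psi_h\in C^0(\bar\Omega):\ \psi_h|_K\in P_2(K)\ \forall K\}$. The pair $(\mathbf X_h,M_h)$ satisfies the inf-sup condition: there is $\beta_*>0$ with $\inf_{0\ne q\in M_h}\sup_{0\ne\mathbf v\in\mathbf X_h}\frac{-(\nabla\cdot\mathbf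 v,q)}{\|\mathbf v\|_{H^1}\|q\|_{L^2}}\ge\beta_*$. Forms: $a(w,\phi)=(\nabla w,\nabla\phi)$, $\tilde a(\mathbf u,\mathbf v)=(\nabla\mathbf u,\nabla\mathbf v)$, $b(\mathbf u,\mathbf v,\mathbf w)=((\mathbf u\cdot\nabla)\mathbf v,\mathbf w)+\frac12((\nabla\cdot\mathbf u)\mathbf v,\mathbf w)$. P-BDF1 scheme: given $(\phi_h^n,\mathbf u_h^n,p_h^n)\in Y_h\times\mathbf V_h\times M_h$ and $U^n\in C^0(\Omega)$, find $(\phi_h^{n+1},w_h^{n+1},\tilde{\mathbf u}_h^{n+1},\mathbf u_h^{n+1},p_h^{n+1})\in Y_h\times Y_h\times\mathbf X_h\times\mathbf V_h\times M_h$, $U^{n+1}\in C^0(\Omega)$ and $\hat{\mathbf u}^{n+1}\in(L^2(\Omega))^d$ such that, with $U_h^n\in Y_h$ the $L^2$ projection of $U^n$, i.e. $(U_h^n,\mu_h)=(U^n,\mu_h)$ for all $\mu_h\in Y_h$: (i) $\left(\frac{\phi_h^{n+1}-\phi_h^n}{\tau},\varphi_h\right)-(\hat{\mathbf u}^{n+1}\phi_h^n,\nabla\varphi_h)+\gamma a(w_h^{n+1},\varphi_h)=0$ for all $\varphi_h\in Y_h$; (ii) $(w_h^{n+1},\psi_h)-\lambda a(\phi_h^{n+1},\psi_h)-\lambda(H(\phi_h^n)U^{n+1},\psi_h)=0$ for all $\psi_h\in Y_h$; (iii) $\hat{\mathbf u}^{n+1}=\mathbf u_h^n-\tau\phi_h^n\nabla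 w_h^{n+1}$; (iv) $U^{n+1}=U_h^n+\frac12H(\phi_h^n)(\phi_h^{n+1}-\phi_h^n)$; (v) $\left(\frac{\tilde{\mathbf u}_h^{n+1}-\mathbf u_h^n}{\tau},\mathbf v_h\right)+\mu\tilde a(\tilde{\mathbf u}_h^{n+1},\mathbf v_h)+b(\mathbf u_h^n,\tilde{\mathbf u}_h^{n+1},\mathbf v_h)-(p_h^n,\nabla\cdot\mathbf v_h)+(\phi_h^n\nabla w_h^{n+1},\mathbf v_h)=0$ for all $\mathbf v_h\in\mathbf X_h$; (vi) $\left(\frac{\mathbf u_h^{n+1}-\tilde{\mathbf u}_h^{n+1}}{\tau},\chi_h\right)-(p_h^{n+1}-p_h^n,\nabla\cdot\chi_h)=0$ for all $\chi_h\in\mathbf V_h$, and $(\nabla\cdot\mathbf u_h^{n+1},q_h)=0$ for all $q_h\in M_h$. Initial data: $\phi_h^0$ and $\mathbf u_h^0$ are the $L^2$ projections of given $\phi_0$, $\mathbf u_0$ onto $Y_h$ and $\mathbf X_h$, $U^0=\sqrt{F(\phi_0)+B}\in C^0(\Omega)$, and $p_h^0\in M_h$ is given. *)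

(* Defs.v *)
From HB Require Import structures.
From mathcomp Require Import all_boot all_order all_algebra.
From mathcomp Require Import all_classical all_reals all_analysis.
From mathcomp Require mpoly.
Import Order.TTheory GRing.Theory Num.Theory.
Import numFieldNormedType.Exports.

Set Implicit Arguments.
Unset Strict Implicit.
Unset Printing Implicit Defensive.

Local Open Scope classical_set_scope.
Local Open Scope ring_scope.

Definition rV_display : measure_display -> measure_display.
Proof. exact. Qed.

(* The product sigma-algebra on row vectors, as the library does for tuples;
   on 'rV[R]_n it is the Borel sigma-algebra. *)
Section rV_measurable.
Context {d : measure_display} {T : measurableType d} (n : nat).

Let coors : 'I_n -> 'rV[T]_n -> T := fun i v => v ord0 i.

Let rV_set0 : g_sigma_preimage coors set0.
Proof. exact: sigma_algebra0. Qed.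

Let rV_setC A : g_sigma_preimage coors A -> g_sigma_preimage coors (~` A).
Proof. exact: sigma_algebraC. Qed.

Let rV_bigcup (F : _^nat) : (forall i, g_sigma_preimage coors (F i)) ->
  g_sigma_preimage coors (\bigcup_i (F i)).
Proof. exact: sigma_algebra_bigcup. Qed.

HB.instance Definition _ := @isMeasurable.Build (rV_display d)
  'rV[T]_n (g_sigma_preimage coors) rV_set0 rV_setC rV_bigcup.

End rV_measurable.

Lemma measurable_coord d (T : measurableType d) n (i : 'I_n) :
  measurable_fun [set: 'rV[T]_n] (fun v : 'rV[T]_n => v ord0 i).
Proof.
move=> _ Y mY; rewrite setTI; apply: sub_sigma_algebra => /=.
rewrite -bigcup_seq/=; exists i => /=; first by rewrite mem_index_enum.
by exists Y => //; rewrite setTI.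
Qed.

Lemma measurable_fun_rVP d1 d2 (T1 : measurableType d1)
    (T2 : measurableType d2) n (f : T1 -> 'rV[T2]_n) :
  measurable_fun [set: T1] f <->
  forall i, measurable_fun [set: T1] (fun x => f x ord0 i).
Proof.
split=> [mf i|mf].
  exact: (measurableT_comp (measurable_coord i) mf).
move=> _; apply: (@measurability _ _ _ _ _ _
  (\big[setU/set0]_(i < n) preimage_set_system setT
     (fun v : 'rV[T2]_n => v ord0 i) measurable)) => //.
move=> A [B]; rewrite -bigcup_seq/= => -[i _ [C mC <-]] <-.
by rewrite !setTI; have := mf i measurableT C mC; rewrite setTI.
Qed.

Section lebesgueS.
Local Open Scope ereal_scope.
Context {R : realType} (n : nat).
Variable m : {sigma_finite_measure set 'rV[R]_n -> \bar R}.

Definition rV_cons (p : measurableTypeR R * 'rV[R]_n) : 'rV[R]_n.+1 :=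
  row_mx (\row_(_ < 1) p.1) p.2.

Let rV_uncons (v : 'rV[R]_n.+1) : measurableTypeR R * 'rV[R]_n :=
  (v ord0 ord0, @rsubmx _ 1 1 n v).

Let rV_consK : cancel rV_cons rV_uncons.
Proof.
move=> [a v]; rewrite /rV_uncons /rV_cons row_mxKr; congr pair.
have e0 : @lshift 1 n ord0 = @ord0 n by exact: val_inj.
have := row_mxEl (\row_(_ < 1) a) v ord0 ord0.
by rewrite e0 mxE.
Qed.

Let measurable_rV_cons : measurable_fun setT rV_cons.
Proof.
apply/measurable_fun_rVP => i.
have [j ->|j ->] := @split_ordP 1 n i.
  rewrite (_ : (fun _ => _) = fst); first exact: measurable_fst.
  by apply/funext => p; have := row_mxEl (\row_(_ < 1) p.1) p.2 ord0 j;
    rewrite mxE.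
rewrite (_ : (fun _ => _) =
    (fun p : measurableTypeR R * 'rV[R]_n => p.2 ord0 j)); last first.
  by apply/funext => p; exact: (row_mxEr (\row_(_ < 1) p.1) p.2 ord0 j).
exact: (measurableT_comp (measurable_coord j) measurable_snd).
Qed.

Let measurable_rV_uncons : measurable_fun setT rV_uncons.
Proof.
apply/measurable_fun_pairP; split; first exact: measurable_coord.
apply/measurable_fun_rVP => i.
under eq_fun do rewrite /= mxE.
exact: measurable_coord.
Qed.

Definition lebesgueS : set 'rV[R]_n.+1 -> \bar R :=
  pushforward (@lebesgue_measure R \x m) rV_cons.

Let lebesgueS0 : lebesgueS set0 = 0.
Proof. exact: measure0. Qed.

Let lebesgueS_ge0 A : 0 <= lebesgueS A.
Proof. exact: measure_ge0. Qed.

Let lebesgueS_sigma_additive : semi_sigma_additive lebesgueS.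
Proof. exact: measure_semi_sigma_additive. Qed.

HB.instance Definition _ := isMeasure.Build _ _ _ lebesgueS
  lebesgueS0 lebesgueS_ge0 lebesgueS_sigma_additive.

Let lebesgueS_sigma_finite : sigma_finite setT lebesgueS.
Proof.
have /sigma_finiteP[F [TF ndF Foo]] := sigma_finiteT (@lebesgue_measure R).
have /sigma_finiteP[G [TG ndG Goo]] := sigma_finiteT m.
exists (fun k => rV_uncons @^-1` (F k `*` G k)).
  rewrite -preimage_bigcup; apply/esym/seteqP; split=> // v _.
  have [i _ Fi] : (\bigcup_k F k) (rV_uncons v).1 by rewrite -TF.
  have [j _ Gj] : (\bigcup_k G k) (rV_uncons v).2 by rewrite -TG.
  exists (maxn i j) => //; split.
  - exact: (subsetPset _ _ (ndF _ _ (leq_maxl i j))) Fi.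
  - exact: (subsetPset _ _ (ndG _ _ (leq_maxr i j))) Gj.
move=> k; have [mF Fk] := Foo k; have [mG Gk] := Goo k; split.
  rewrite -[X in measurable X]setTI; apply: measurable_rV_uncons => //.
  exact: measurableX.
rewrite /lebesgueS /pushforward -comp_preimage.
rewrite (_ : rV_uncons \o rV_cons = id); last exact/funext.
by rewrite product_measure1E// lte_mul_pinfty// ge0_fin_numE.
Qed.

HB.instance Definition _ := Measure_isSigmaFinite.Build _ _ _ lebesgueS
  lebesgueS_sigma_finite.

End lebesgueS.

Fixpoint lebesgue {R : realType} n :
    {sigma_finite_measure set 'rV[R]_n -> \bar R} :=
  match n with
  | 0 => \d_(0 : 'rV[R]_0)
  | n'.+1 => lebesgueS (lebesgue n')
  end.

Section calculus.
Context {R : realType} {d : nat}.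
Local Notation V := 'rV[R]_d.

Definition dotv (u v : V) : R := \sum_(i < d) u ord0 i * v ord0 i.

Definition enorm (v : V) : R := Num.sqrt (dotv v v).

Definition partial (i : 'I_d) (f : V -> R) (x : V) : R :=
  'D_(delta_mx ord0 i) f x.

(* Classical derivatives, pointwise.  On finite element functions they exist
   in the interior of every element, hence almost everywhere, and there they
   agree with the weak derivatives; elsewhere 'D_ takes a default value. *)
Definition grad (f : V -> R) (x : V) : V := \row_i partial i f x.

Definition vcomp (v : V -> V) (i : 'I_d) (x : V) : R := v x ord0 i.

Definition divg (v : V -> V) (x : V) : R :=
  \sum_(i < d) partial i (vcomp v i) x.

(* The vector field (u . nabla) v. *)
Definition advect (u v : V -> V) (x : V) : V :=
  \row_j dotv (u x) (grad (vcomp v j) x).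

Fixpoint Ck (k : nat) (f : V -> R) : Prop :=
  match k with
  | 0 => continuous f
  | k'.+1 => continuous f /\
      forall i, (forall x, derivable f x (delta_mx ord0 i)) /\
                Ck k' (partial i f)
  end.

Variable Omega : set V.

Definition bounded_domain : Prop :=
  [/\ open Omega, connected Omega, Omega !=set0 & bounded_set Omega].

Definition ip (f g : V -> R) : R := \int[lebesgue d]_(x in Omega) (f x * g x).

Definition ipv (u v : V -> V) : R :=
  \int[lebesgue d]_(x in Omega) dotv (u x) (v x).

Definition L2 (f : V -> R) : Prop :=
  measurable_fun Omega f /\
  (lebesgue d).-integrable Omega (fun x => (f x ^+ 2)%:E).

Definition L2v (u : V -> V) : Prop := forall i, L2 (vcomp u i).

Definition L20 (q : V -> R) : Prop :=
  L2 q /\ \int[lebesgue d]_(x in Omega) q x = 0.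

Definition C0 (f : V -> R) : Prop := {within closure Omega, continuous f}.

Definition C0v (v : V -> V) : Prop := {within closure Omega, continuous v}.

Definition test_function (f : V -> R) : Prop :=
  (forall k, Ck k f) /\
  compact (closure [set x | f x != 0]) /\
  closure [set x | f x != 0] `<=` Omega.

Definition weak_grad (f : V -> R) (g : V -> V) : Prop :=
  forall h, test_function h ->
  forall i, ip f (partial i h) = - ip (vcomp g i) h.

(* H^1_0 is the closure of the test functions in the H^1 norm. *)
Definition H10 (f : V -> R) : Prop :=
  L2 f /\ exists g, [/\ L2v g, weak_grad f g &
    forall e : R, 0 < e -> exists h, test_function h /\
      ip (f \- h) (f \- h) + ipv (g \- grad h) (g \- grad h) < e].

Definition H10v (v : V -> V) : Prop := forall i, H10 (vcomp v i).

Definition form_a (w f : V -> R) : R := ipv (grad w) (grad f).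

Definition form_at (u v : V -> V) : R :=
  \sum_(i < d) form_a (vcomp u i) (vcomp v i).

Definition form_b (u v w : V -> V) : R :=
  ipv (advect u v) w + 2^-1 * ipv (fun x => divg u x *: v x) w.

Definition L2norm (f : V -> R) : R := Num.sqrt (ip f f).

Definition H1normv (v : V -> V) : R := Num.sqrt (ipv v v + form_at v v).

Definition L2proj (Y : set (V -> R)) (f Pf : V -> R) : Prop :=
  Y Pf /\ forall h, Y h -> ip Pf h = ip f h.

Definition L2projv (X : set (V -> V)) (u Pu : V -> V) : Prop :=
  X Pu /\ forall v, X v -> ipv Pu v = ipv u v.

End calculus.

Section mesh.
Context {R : realType} {d : nat}.
Local Notation V := 'rV[R]_d.

Definition conv_hull m (p : 'I_m -> V) : set V :=
  [set x | exists t : 'I_m -> R, [/\ forall i, 0 <= t i,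
    \sum_(i < m) t i = 1 & x = \sum_(i < m) t i *: p i]].

(* Elements are closed convex polytopes with nonempty interior, such as
   triangles and tetrahedra. *)
Definition element (K : set V) : Prop :=
  (exists m (p : 'I_m -> V), K = conv_hull p) /\ interior K !=set0.

Definition partition_of (Omega : set V) N (K : 'I_N -> set V) : Prop :=
  [/\ forall i, element (K i), closure Omega = \bigcup_i K i &
      forall i j, i != j -> interior (K i) `&` interior (K j) = set0].

Definition diam (K : set V) : R :=
  sup [set r | exists x y, [/\ K x, K y & r = enorm (x - y)]].

(* The supremum of the diameters of the Euclidean balls contained in K. *)
Definition indiam (K : set V) : R :=
  sup [set r | 0 <= r /\ exists c, [set x | enorm (x - c) <= r / 2] `<=` K].

Definition shape_regular (sigma : R) N (K : 'I_N -> set V) : Prop :=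
  forall i, diam (K i) <= sigma * indiam (K i).

Definition quasi_uniform (kappa : R) N (K : 'I_N -> set V) : Prop :=
  forall i j, diam (K i) <= kappa * diam (K j).

Definition Pk (k : nat) (K : set V) (f : V -> R) : Prop :=
  exists p : mpoly.mpoly d R,
    (forall m, mpoly.mcoeff m p != 0 -> (mpoly.mdeg m <= k)%N) /\
    forall x, K x -> f x = mpoly.meval (fun i => x ord0 i) p.

Variables (Omega : set V) (N : nat) (K : 'I_N -> set V).

Definition Xh : set (V -> V) :=
  [set v | [/\ C0v Omega v, H10v Omega v &
               forall l i, Pk 2 (K l) (vcomp v i)]].

Definition Vh : set (V -> V) := Xh.

Definition Mh : set (V -> R) :=
  [set q | [/\ C0 Omega q, L20 Omega q & forall l, Pk 1 (K l) q]].

Definition Yh : set (V -> R) :=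
  [set f | C0 Omega f /\ forall l, Pk 2 (K l) f].

Definition inf_sup (beta : R) : Prop :=
  (beta%:E <= ereal_inf [set
    ereal_sup [set (- ip Omega (divg v) q /
                      (H1normv Omega v * L2norm Omega q))%:E |
               v in [set v | Xh v /\ exists x, closure Omega x /\ v x != 0%R]] |
    q in [set q | Mh q /\ exists x, closure Omega x /\ q x != 0%R]])%E.

End mesh.

Section scheme.
Context {R : realType} {d : nat}.
Local Notation V := 'rV[R]_d.

Definition potential (F : R -> R) (B : R) : Prop :=
  [/\ forall s, derivable F s 1, continuous (derive1 F),
      exists m, forall s, m <= F s & forall s, 0 < F s + B].

Definition Hfun (F : R -> R) (B s : R) : R :=
  derive1 F s / Num.sqrt (F s + B).

Variables (Omega : set V) (N : nat) (K : 'I_N -> set V).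
Variables (F : R -> R) (B gam lam mu tau : R).

(* One step, from (phi, u, p, U) to (phi', w', ut', u', p', U', uh'), where
   ut is the intermediate velocity and uh the velocity with a hat. *)
Definition pbdf1_step (phi : V -> R) (u : V -> V) (p U : V -> R)
    (phi' w' : V -> R) (ut' u' : V -> V) (p' U' : V -> R) (uh' : V -> V)
    : Prop :=
  [/\ Yh Omega K phi', Yh Omega K w', Xh Omega K ut', Vh Omega K u' &
      Mh Omega K p'] /\
  [/\ C0 Omega U', L2v Omega uh' &
    (forall psi, Yh Omega K psi ->
       ip Omega (fun x => (phi' x - phi x) / tau) psi
       - ipv Omega (fun x => phi x *: uh' x) (grad psi)
       + gam * form_a Omega w' psi = 0) /\
    (forall psi, Yh Omega K psi ->
       ip Omega w' psi - lam * form_a Omega phi' psi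
       - lam * ip Omega (fun x => Hfun F B (phi x) * U' x) psi = 0) /\
    {ae lebesgue d, forall x, Omega x ->
       uh' x = u x - (tau * phi x) *: grad w' x} /\
    (exists Uh, L2proj Omega (Yh Omega K) U Uh /\
       forall x, closure Omega x ->
         U' x = Uh x + 2^-1 * Hfun F B (phi x) * (phi' x - phi x)) /\
    (forall v, Xh Omega K v ->
       ipv Omega (fun x => tau^-1 *: (ut' x - u x)) v
       + mu * form_at Omega ut' v + form_b Omega u ut' v
       - ip Omega p (divg v)
       + ipv Omega (fun x => phi x *: grad w' x) v = 0) /\
    (forall v, Vh Omega K v ->
       ipv Omega (fun x => tau^-1 *: (u' x - ut' x)) v
       - ip Omega (p' \- p) (divg v) = 0) /\
    (forall q, Mh Omega K q -> ip Omega (divg u') q = 0)].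

Definition pbdf1_init (phi0 : V -> R) (u0 : V -> V)
    (phi : V -> R) (u : V -> V) (p U : V -> R) : Prop :=
  [/\ L2 Omega phi0 /\ L2proj Omega (Yh Omega K) phi0 phi,
      L2v Omega u0 /\ L2projv Omega (Xh Omega K) u0 u,
      Mh Omega K p, C0 Omega U &
      forall x, closure Omega x -> U x = Num.sqrt (F (phi0 x) + B)].

End scheme.

(* Main.v *)
(* Testing the discrete Cahn-Hilliard equation with the constant 1, which lies
   in Y_h and has zero gradient, gives ((phi^{n+1} - phi^n) / tau, 1) = 0.
   Splitting this integral needs the integrability of finite element functions:
   they are continuous on the compact closure of Omega, hence bounded, and
   Omega has finite measure. *)
Require Import Defs.
From HB Require Import structures.
From mathcomp Require Import all_boot all_order all_algebra.
From mathcomp Require Import all_classical all_reals all_analysis.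
From mathcomp Require Import measurable_realfun lra.
From mathcomp Require mpoly.
Import Order.TTheory GRing.Theory Num.Theory.
Import numFieldNormedType.Exports.

Set Implicit Arguments.
Unset Strict Implicit.
Unset Printing Implicit Defensive.

Local Open Scope classical_set_scope.
Local Open Scope ring_scope.

(** The metric on row vectors is the sup metric, so a ball is a finite intersection of coordinate
    preimages of intervals. *)
Lemma rV_ball_measurable (R : realType) (d : nat) (c : 'rV[R]_d) (r : R) :
  measurable (ball c r).
Proof.
(* Membership in a ball of row vectors includes [0 < r]; for [d = 0] the coordinate conditions alone
   would not force it. *)
have [r0|r0] := ltP 0 r; last first.
  rewrite (_ : ball c r = set0); first exact: measurable0.
  by apply/seteqP; split=> // v [] /(le_lt_trans r0); rewrite ltxx.
rewrite (_ : ball c r =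
    \bigcap_(i in [set: 'I_d]) ((fun v : 'rV[R]_d => v ord0 i) @^-1`
      ball (c ord0 i) r)).
  apply: fin_bigcap_measurable => // i _.
  rewrite -[X in measurable X]setTI; apply: measurable_coord => //.
  by apply: open_measurable; exact: ball_open.
apply/seteqP; split=> [v [_ cv] i _|v cv]; first exact: cv.
by split=> // k i; rewrite ord1; exact: cv.
Qed.

Lemma rV_open_subball_rat (R : realType) (d : nat) (A : set 'rV[R]_d) x :
  open A -> A x -> exists (c : 'rV[rat]_d) (r : rat),
    ball (map_mx (@ratr R) c) (ratr r) x /\
    ball (map_mx (@ratr R) c) (ratr r) `<=` A.
Proof.
move=> oA Ax; have /nbhs_ballP[e /= e0 xeA] := open_nbhs_nbhs (conj oA Ax).
have e20 : 0 < e / 2 by rewrite divr_gt0.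
(* A rational radius below [e / 2] and a center with each coordinate in []x_i, x_i + r[] put [x] in
   the ball, and the triangle inequality keeps the ball within [e] of [x]. *)
have [r] := rat_in_itvoo e20; rewrite in_itv/= => /andP[r0 re].
have xr i : exists q : rat, x ord0 i < ratr q < x ord0 i + ratr r.
  have /rat_in_itvoo[q] : x ord0 i < x ord0 i + ratr r by rewrite ltrDl.
  by rewrite in_itv/=; exists q.
have [c cP] := boolp.choice xr.
have xc : ball (map_mx (@ratr R) (\row_i c i)) (ratr r) x.
  split=> // k i; rewrite ord1 !mxE /ball/=.
  by have /andP[? ?] := cP i; rewrite ger0_norm ?subr_ge0 ?ltW// ltrBlDl.
exists (\row_i c i), r; split=> // y cy; apply: xeA; rewrite (splitr e).
apply: (@ball_triangle _ _ (map_mx (@ratr R) (\row_i c i))).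
  exact/ball_sym/(le_ball (ltW re)).
exact: le_ball (ltW re) _ cy.
Qed.

(** Second countability: an open set is the union of the countably many rational balls inside it.
    This links the topology to the coordinate sigma-algebra. *)
Lemma rV_open_measurable (R : realType) (d : nat) (A : set 'rV[R]_d) :
  open A -> measurable A.
Proof.
move=> oA.
pose B (i : 'rV[rat]_d * rat) := ball (map_mx (@ratr R) i.1) (ratr i.2).
(* Balls not inside [A] are replaced by the empty set, so that the union runs over a whole countable
   type. *)
rewrite (_ : A = \bigcup_i (if `[< B i `<=` A >] then B i else set0)).
  apply: countable_bigcupT_measurable => // i.
  by case: ifP => _; [exact: rV_ball_measurable|exact: measurable0].
apply/seteqP; split=> [x Ax|x [i _]].
  have [c [r [xcr crA]]] := rV_open_subball_rat oA Ax.
  by exists (c, r) => //; rewrite asboolT.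
by case: ifPn => // /asboolP; exact.
Qed.

(** The preimage of an open interval is relatively open in [D], hence open because [D] is. *)
Lemma rV_open_continuous_measurable_fun (R : realType) (d : nat)
    (D : set 'rV[R]_d) (f : 'rV[R]_d -> R) :
  open D -> {within D, continuous f} -> measurable_fun D f.
Proof.
move=> oD /continuousP cf.
apply: (measurability _ (RGenOpens.measurableE R)) => _ [_ [a [b ->] <-]].
have /open_subspaceP[V oV VD] := cf _ (@interval_open _ (BRight a) (BLeft b) isT isT).
by rewrite setIC -VD; apply: rV_open_measurable; exact: openI.
Qed.

(** Induction on the dimension: the measure starts from a Dirac mass, and in each further dimension
    the cube pulls back to an interval times a lower cube. *)
Lemma lebesgue_cube_lty (R : realType) (d : nat) (M : R) :
  measurable [set v : 'rV[R]_d | forall i, `|v ord0 i| <= M] /\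
  (lebesgue d [set v : 'rV[R]_d | (forall i, `|v ord0 i| <= M)%R] < +oo)%E.
Proof.
have mcube n : measurable [set v : 'rV[R]_n | forall i, `|v ord0 i| <= M].
  rewrite (_ : [set _ | _] = \bigcap_(i in [set: 'I_n])
      ((fun v : 'rV[R]_n => v ord0 i) @^-1` `[- M, M])).
    apply: fin_bigcap_measurable => // i _.
    by rewrite -[X in measurable X]setTI; apply: measurable_coord.
  apply/seteqP; split=> [v vM i _|v vM i] /=; first by rewrite in_itv/= -ler_norml.
  by have := vM i Logic.I; rewrite /= in_itv/= -ler_norml.
split=> //; elim: d => [|d IH] /=.
  by rewrite /= diracE; case: (_ \in _); rewrite ltry.
rewrite /lebesgueS /pushforward.
rewrite (_ : _ @^-1` _ = (`[- M, M] : set R) `*`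
    [set v : 'rV[R]_d | forall i, `|v ord0 i| <= M]); last first.
  have consl (a : R) v : @rV_cons R d (a, v) ord0 (@lshift 1 d ord0) = a.
    by rewrite /rV_cons (row_mxEl (\row_(_ < 1) a) v ord0 ord0) mxE.
  have consr (a : R) v i : @rV_cons R d (a, v) ord0 (@rshift 1 d i) = v ord0 i.
    exact: (row_mxEr (\row_(_ < 1) a) v ord0 i).
  apply/seteqP; split=> [[a v] avM|[a v] [aM vM] i].
    split=> [/=|i /=]; last by rewrite -(consr a).
    by rewrite in_itv/= -ler_norml -(consl a v).
  have [j ->|j ->] := @split_ordP 1 d i; last by rewrite consr; exact: vM.
  by rewrite (ord1 j) consl ler_norml; move: aM; rewrite /= in_itv.
rewrite product_measure1E//=; last exact: mcube.
rewrite lte_mul_pinfty//.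
by rewrite ge0_fin_numE//= lebesgue_measure_itv; case: ifP; rewrite ltry.
Qed.

Lemma lebesgue_bounded_lty (R : realType) (d : nat) (A : set 'rV[R]_d) :
  measurable A -> bounded_set A -> (lebesgue d A < +oo)%E.
Proof.
move=> mA [M [_ AM]]; have [mC C] := lebesgue_cube_lty d (M + 1).
apply: le_lt_trans C; apply: le_measure; rewrite ?inE// => v Av i.
have {}Av : `|v| <= M + 1 by apply: AM Av; rewrite ltrDl.
apply: le_trans Av; rewrite [leRHS]/Num.Def.normr/= mx_normrE.
exact: (@le_bigmax _ _ _ 0 (fun x : 'I_1 * 'I_d => `|v x.1 x.2|) (ord0, i)).
Qed.

Lemma rV_bounded_closure (R : realType) (d : nat) (A : set 'rV[R]_d) :
  bounded_set A -> bounded_set (closure A).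
Proof.
move=> [M [Mr AM]]; exists (M + 1); split; first exact: num_real.
move=> x Mx v Av; have [w [Aw vw]] := Av _ (nbhsx_ballx v 1 ltr01).
(* The bound on [w] is [x - 1], which exceeds [M]; the distance below 1 from [v] to [w] then gives
   [x] for [v]. *)
have : `|w| <= M + (x - M - 1) by apply: AM Aw; rewrite ltrDl; lra.
move: vw; rewrite -ball_normE /=.
by have := ler_normD (v - w) w; rewrite subrK; lra.
Qed.

Lemma C0_integrable (R : realType) (d : nat) (Omega : set 'rV[R]_d)
    (f : 'rV[R]_d -> R) :
  open Omega -> bounded_set Omega -> C0 Omega f ->
  (lebesgue d).-integrable Omega (EFin \o f).
Proof.
move=> oO bO cf; have mO := rV_open_measurable oO.
apply: measurable_bounded_integrable => //.
- exact: lebesgue_bounded_lty.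
- apply: rV_open_continuous_measurable_fun => //.
  exact: continuous_subspaceW (@subset_closure _ _) cf.
- have cO : compact (closure Omega).
    apply: bounded_closed_compact; last exact: closed_closure.
    exact: rV_bounded_closure.
  have [M [Mr fM]] := compact_bounded (continuous_compact cf cO).
  exists M; split=> // x Mx v Ov; apply: fM Mx _ _.
  by exists v => //; exact: subset_closure.
Qed.

Lemma grad_cst (R : realType) (d : nat) (a : R) :
  grad (cst a : 'rV[R]_d -> R) = cst 0.
Proof.
by apply/funext => x; apply/rowP => i; rewrite !mxE /partial derive_cst.
Qed.

(** The integrand vanishes pointwise, so [u] may be arbitrary; this removes the convective and the
    diffusive term at once. *)
Lemma ipv0r (R : realType) (d : nat) (Omega : set 'rV[R]_d)
    (u : 'rV[R]_d -> 'rV[R]_d) : ipv Omega u (cst 0) = 0.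
Proof.
rewrite /ipv /Rintegral integral0_eq// => x _.
by rewrite /dotv big1// => i _; rewrite mxE mulr0.
Qed.

Lemma Yh_cst1 (R : realType) (d : nat) (Omega : set 'rV[R]_d) (N : nat)
    (K : 'I_N -> set 'rV[R]_d) : Yh Omega K (cst 1).
Proof.
split=> [|l]; first by apply: continuous_subspaceT => x; exact: cst_continuous.
exists (mpoly.mpolyC d 1); split=> [m|x _]; last by rewrite mpoly.mevalC.
(* A nonzero coefficient of the constant polynomial can only sit at the trivial monomial, of degree
   0. *)
rewrite mpoly.mcoeffC mul1r pnatr_eq0 eqb0 negbK => /eqP ->.
by rewrite mpoly.mdeg0.
Qed.

Lemma pbdf1_step_mass (R : realType) (d : nat) (Omega : set 'rV[R]_d)
    (N : nat) (K : 'I_N -> set 'rV[R]_d) (F : R -> R)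
    (B gam lam mu tau : R) (phi phi' w' p p' U U' : 'rV[R]_d -> R)
    (u ut' u' uh' : 'rV[R]_d -> 'rV[R]_d) :
  open Omega -> bounded_set Omega -> tau != 0 -> C0 Omega phi ->
  pbdf1_step Omega K F B gam lam mu tau phi u p U phi' w' ut' u' p' U' uh' ->
  \int[lebesgue d]_(x in Omega) phi' x = \int[lebesgue d]_(x in Omega) phi x.
Proof.
move=> oO bO tau0 cphi [[[cphi' _] _ _ _ _] [_ _ [mass _]]].
have mO := rV_open_measurable oO.
have iphi := C0_integrable oO bO cphi.
have iphi' := C0_integrable oO bO cphi'.
have := mass _ (Yh_cst1 Omega K).
rewrite /form_a grad_cst !ipv0r mulr0 subr0 addr0 /ip.
under eq_Rintegral do rewrite /= mulr1.
(* Moving [tau^-1] out of the integral requires the difference [phi' - phi] to be integrable. *)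
rewrite RintegralZr//; last first.
  rewrite (_ : _ \o _ = (EFin \o phi') \- (EFin \o phi))%E//.
  exact: integrableB.
rewrite RintegralB// => /eqP.
by rewrite mulf_eq0 invr_eq0 (negbTE tau0) orbF subr_eq0 => /eqP.
Qed.

Theorem lemma3p6 (R : realType) (d : nat) (d23 : d = 2%N \/ d = 3%N)
    (Omega : set 'rV[R]_d) (OmegaP : bounded_domain Omega)
    (gam lam mu tau : R)
    (gam_gt0 : 0 < gam) (lam_gt0 : 0 < lam) (mu_gt0 : 0 < mu)
    (tau_gt0 : 0 < tau)
    (F : R -> R) (B : R) (FB : potential F B)
    (N : nat) (K : 'I_N -> set 'rV[R]_d) (KP : partition_of Omega K)
    (sigma kappa : R)
    (Ksr : shape_regular sigma K) (Kqu : quasi_uniform kappa K)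
    (beta : R) (beta_gt0 : 0 < beta) (XMis : inf_sup Omega K beta)
    (phi0 : 'rV[R]_d -> R) (u0 : 'rV[R]_d -> 'rV[R]_d)
    (phi w p U : nat -> 'rV[R]_d -> R)
    (u ut uh : nat -> 'rV[R]_d -> 'rV[R]_d)
    (init : pbdf1_init Omega K F B phi0 u0 (phi 0%N) (u 0%N) (p 0%N) (U 0%N))
    (n : nat)
    (step : forall m, (m <= n)%N ->
      pbdf1_step Omega K F B gam lam mu tau
        (phi m) (u m) (p m) (U m)
        (phi m.+1) (w m.+1) (ut m.+1) (u m.+1) (p m.+1) (U m.+1) (uh m.+1)) :
  \int[lebesgue d]_(x in Omega) phi n.+1 x =
  \int[lebesgue d]_(x in Omega) phi 0%N x.
Proof.
have [oO _ _ bO] := OmegaP.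
(* The initial phase field is continuous as an [L2] projection onto [Yh], every later one as the
   output of the preceding step. *)
have phiC m : (m <= n)%N -> C0 Omega (phi m).
  case: m => [_|m mn]; first by case: init => -[_ [[]]].
  by have [[[]]] := step _ (ltnW mn).
elim: n step phiC => [|k IH] step phiC.
  exact: pbdf1_step_mass oO bO (lt0r_neq0 tau_gt0) (phiC _ _) (step _ _).
(* The induction hypothesis replaces the initial mass by that of [phi k.+1], leaving a single step
   of the scheme. *)
rewrite -IH.
- exact: pbdf1_step_mass oO bO (lt0r_neq0 tau_gt0) (phiC _ _) (step _ _).
- by move=> m mk; apply: step; exact: leqW.
- by move=> m mk; apply: phiC; exact: leqW.
Qed.
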